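(* Let $G$ be the group given by the presentation $$G=\langle\, a,s,t \mid a^2=1,\ [a,a^t]=1,\ [s,t]=1,\ a^s=aa^t \,\rangle,$$ and let $\mathcal A=\{a,s,t,at,ta,ata,as,sa,asa\}$. Then $G$ is finitely presented and has unbounded dead-end depth with respect to $\mathcal A$: for every $N\ge 1$ there is an element $g\in G$ whose depth with respect to $\mathcal A$ is at least $N$.
   Context: Notation: $[x,y]=x^{-1}y^{-1}xy$ and $x^y=y^{-1}xy$. For a finite generating set $\mathcal A$ of a group $G$, $d_{\mathcal A}$ denotes the word metric, i.e. the path metric on the Cayley graph of $(G,\mathcal A)$; here $d_{\mathcal A}(g,h)$ is the length of a shortest word in $\mathcal A\cup\mathcal A^{-1}$ representing $g^{-1}h$. The depth of $g\in G$ with respect to $\mathcal A$ is the distance, in $d_{\mathcal A}$, from $g$ to the complement in $G$ of the closed ball $\{h\in G: d_{\mathcal A}(1,h)\le d_{\mathcal A}(1,g)\}$. The group $G$ has unbounded dead-end depth with respect to $\mathcal A$ if the depths of its elements are not bounded above. *)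

(* Defs.v *)
From Stdlib Require List.
From mathcomp Require Import all_boot.
Set Implicit Arguments.
Unset Strict Implicit.
Unset Printing Implicit Defensive.

Inductive gen := ga | gs | gt.

(* a letter: a generator together with an exponent flag (true = inverse) *)
Definition letter := (gen * bool)%type.
Definition linv (x : letter) : letter := (x.1, ~~ x.2).
Definition winv (w : seq letter) : seq letter := rev (map linv w).

Definition A : seq letter := [:: (ga, false)].
Definition S : seq letter := [:: (gs, false)].
Definition T : seq letter := [:: (gt, false)].
Definition conj (x y : seq letter) := winv y ++ x ++ y.
Definition comm (x y : seq letter) := winv x ++ winv y ++ x ++ y.

(* relators r (meaning r = 1):
   a^2,  [a, a^t],  [s,t],  (a^s)^{-1} (a a^t)   (from a^s = a a^t) *)
Definition relators : list (seq letter) :=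
  [:: A ++ A; comm A (conj A T); comm S T; winv (conj A S) ++ A ++ conj A T].

Inductive gequiv : seq letter -> seq letter -> Prop :=
| ge_refl w : gequiv w w
| ge_sym u v : gequiv u v -> gequiv v u
| ge_trans u v w : gequiv u v -> gequiv v w -> gequiv u w
| ge_free p q x : gequiv (p ++ x :: linv x :: q) (p ++ q)
| ge_rel p q r : List.In r relators -> gequiv (p ++ r ++ q) (p ++ q).

Inductive agen := Xa | Xs | Xt | Xat | Xta | Xata | Xas | Xsa | Xasa.

Definition aword (x : agen) : seq letter :=
  match x with
  | Xa => A | Xs => S | Xt => T
  | Xat => A ++ T | Xta => T ++ A | Xata => A ++ T ++ A
  | Xas => A ++ S | Xsa => S ++ A | Xasa => A ++ S ++ A
  end.

Definition aeval (u : seq (agen * bool)) : seq letter :=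
  flatten (map (fun y => if y.2 then winv (aword y.1) else aword y.1) u).

Definition dist_le (g h : seq letter) (n : nat) : Prop :=
  exists u : seq (agen * bool), size u <= n /\ gequiv (g ++ aeval u) h.

Definition is_wlen (g : seq letter) (n : nat) : Prop :=
  dist_le [::] g n /\ forall m, dist_le [::] g m -> n <= m.

Definition depth_ge (g : seq letter) (N : nat) : Prop :=
  forall n, is_wlen g n ->
  forall h, ~ dist_le [::] h n ->
  forall m, dist_le g h m -> N <= m.

(* Main.v *)
(* G is the semidirect product of R = F_2[x, 1/x, 1/(1+x)] by Z^2, where t and s
   act as x and 1 + x.  Writing each a of a word at the position (i, j) reached
   by the preceding letters, a word spells a walk in Z^2 together with a sum of
   monomials x^i (1+x)^j over visited positions, and with the generating set
   of the theorem the length of an element is the length of a shortest such walk.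
   Let H_n be the space of f in R with poles of order at most n at infinity, 0
   and 1, i.e. the span of the monomials in the triangle i, j >= -n, i + j <= n.
   An element (f, 0) with f in H_n having all three poles of order exactly n
   needs a closed walk meeting i <= -n, j <= -n and i + j >= n, hence has length
   at least 6n.  Conversely the monomials on three arms of length n from the
   origin span H_n (there are two such tripods), and a tour of the tripod which
   leaves the arm pointing towards d for the end shows that every (f, d) with f in
   H_n and |d| <= n has length at most 6n. *)
Require Import Defs.
From Stdlib Require Import Setoid Morphisms.
From mathcomp Require Import all_boot all_order all_algebra.
From mathcomp Require Import zify ring.
Set Implicit Arguments.
Unset Strict Implicit.
Unset Printing Implicit Defensive.
Import Order.TTheory GRing.Theory Num.Theory.

Local Open Scope ring_scope.

(** * Word calculus modulo the relations *)

Notation word := (seq letter).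
Notation "u === v" := (gequiv u v) (at level 70, no associativity).

Lemma gequiv_catl w u v : u === v -> w ++ u === w ++ v.
Proof.
elim=> {u v} [u|u v _ H|u v z _ H1 _ H2|p q x|p q r Hr].
- exact: Defs.ge_refl.
- exact: Defs.ge_sym.
- exact: Defs.ge_trans H1 H2.
- by rewrite !catA; apply: ge_free.
- by rewrite (catA w p (r ++ q)) (catA w p q); apply: ge_rel.
Qed.

Lemma gequiv_catr w u v : u === v -> u ++ w === v ++ w.
Proof.
elim=> {u v} [u|u v _ H|u v z _ H1 _ H2|p q x|p q r Hr].
- exact: Defs.ge_refl.
- exact: Defs.ge_sym.
- exact: Defs.ge_trans H1 H2.
- by rewrite -!catA; apply: ge_free.
- by rewrite -!catA; apply: ge_rel.
Qed.

#[export] Instance gequiv_Equivalence : Equivalence gequiv.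
Proof. by split; [exact: Defs.ge_refl|exact: Defs.ge_sym|exact: Defs.ge_trans]. Qed.

#[export] Instance cat_gequiv :
  Proper (gequiv ==> gequiv ==> gequiv) (@cat letter).
Proof.
move=> u u' Hu v v' Hv.
exact: Defs.ge_trans (gequiv_catr _ Hu) (gequiv_catl _ Hv).
Qed.

Lemma linvK : involutive linv.
Proof. by case=> x b; rewrite /linv /= negbK. Qed.

Lemma winvK : involutive winv.
Proof. by move=> w; rewrite /winv map_rev revK (mapK linvK). Qed.

Lemma winv_cat u v : winv (u ++ v) = winv v ++ winv u.
Proof. by rewrite /winv map_cat rev_cat. Qed.

Lemma catVw w : winv w ++ w === [::].
Proof.
elim: w => [|x w IH]; first by reflexivity.
rewrite -cat1s winv_cat -catA (catA (winv [:: x])).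
have -> : winv [:: x] ++ [:: x] = [:: linv x; linv (linv x)] by rewrite linvK.
by apply: Defs.ge_trans IH; apply: (ge_free (winv w) w (linv x)).
Qed.

Lemma catwV w : w ++ winv w === [::].
Proof. by have := catVw (winv w); rewrite winvK. Qed.

Lemma catKw u v : winv u ++ u ++ v === v.
Proof. by rewrite catA catVw; reflexivity. Qed.

Lemma catVKw u v : u ++ winv u ++ v === v.
Proof. by rewrite catA catwV; reflexivity. Qed.

Lemma gequiv_cancell u v w : u ++ v === u ++ w -> v === w.
Proof.
move=> H; rewrite -(catKw u v) H catKw; reflexivity.
Qed.

Lemma gequiv_cancelr u v w : v ++ u === w ++ u -> v === w.
Proof.
move=> H; rewrite -[v]cats0 -[w]cats0 -(catwV u) !catA H; reflexivity.
Qed.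

#[export] Instance winv_gequiv : Proper (gequiv ==> gequiv) winv.
Proof.
move=> u v H; apply: (@gequiv_cancell u).
rewrite catwV {1}H catwV; reflexivity.
Qed.

Lemma gequiv_rel r : List.In r relators -> r === [::].
Proof. by move=> Hr; have := ge_rel [::] [::] Hr; rewrite cats0. Qed.

Definition commutes (u v : word) := u ++ v === v ++ u.

#[export] Instance commutes_gequiv :
  Proper (gequiv ==> gequiv ==> iff) commutes.
Proof.
by move=> u u' Hu v v' Hv; rewrite /commutes; split; rewrite Hu Hv.
Qed.

Lemma commutes_sym u v : commutes u v -> commutes v u.
Proof. exact: Defs.ge_sym. Qed.

Lemma commutes_nil u : commutes u [::].
Proof. by rewrite /commutes cats0; reflexivity. Qed.

Lemma commutes_cat u v w : commutes u v -> commutes u w -> commutes u (v ++ w).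
Proof.
rewrite /commutes => H1 H2.
by rewrite catA H1 -catA H2 catA; reflexivity.
Qed.

Lemma commutes_winv u v : commutes u v -> commutes u (winv v).
Proof.
rewrite /commutes => H; apply: (@gequiv_cancell v); apply: (@gequiv_cancelr v).
by rewrite -!catA catVw cats0 catVKw; symmetry.
Qed.

Lemma comm_commutes u v : comm u v === [::] -> commutes u v.
Proof.
rewrite /comm /commutes => H; apply: (@gequiv_cancell (winv u ++ winv v)).
by rewrite -!catA H catKw catVw; reflexivity.
Qed.

Lemma commutes_conj p u v :
  commutes u v -> commutes (p ++ u ++ winv p) (p ++ v ++ winv p).
Proof.
rewrite /commutes => H; rewrite -!catA !catKw (catA u) H -catA; reflexivity.
Qed.

(** * Defining relations, positions and lamps *)

Lemma rel_aa : A ++ A === [::].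
Proof. by apply: gequiv_rel; left. Qed.

Lemma rel_at : commutes A (conj A T).
Proof. by apply: comm_commutes; apply: gequiv_rel; right; left. Qed.

Lemma rel_st : commutes S T.
Proof. by apply: comm_commutes; apply: gequiv_rel; right; right; left. Qed.

Lemma rel_as : conj A S === A ++ conj A T.
Proof.
have H : winv (conj A S) ++ A ++ conj A T === [::].
  by apply: gequiv_rel; do 3 right; left.
by rewrite -[conj A S]cats0 -H catVKw; reflexivity.
Qed.

Lemma winvA : winv A === A.
Proof. by apply: (@gequiv_cancell A); rewrite catwV rel_aa; reflexivity. Qed.

(* Positions are exponents in F_2[x, 1/x, 1/(1+x)]: since a^t and a^s correspond
   to x and 1 + x, it is t^-1 and s^-1 that move by (1, 0) and (0, 1). *)
Definition zpow (g : gen) (z : int) : word :=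
  match z with Posz n => nseq n (g, true) | Negz n => nseq n.+1 (g, false) end.

Definition pos (c : int * int) : word := zpow gt c.1 ++ zpow gs c.2.

(** This conjugate of [a] plays the role of the monomial x^c.1 (1+x)^c.2. *)
Definition lamp (c : int * int) : word := pos c ++ A ++ winv (pos c).

Lemma nseqSr (X : Type) n (x : X) : nseq n.+1 x = nseq n x ++ [:: x].
Proof. by rewrite -addn1 nseqD. Qed.

Lemma zpowS g z : zpow g (z + 1) === zpow g z ++ [:: (g, true)].
Proof.
case: z => [n|[|n]].
- rewrite -[(Posz n + 1)]/(Posz (n + 1)) addn1 /zpow -nseqSr; reflexivity.
- by symmetry; apply: (ge_free [::] [::] (g, false)).
- have -> : Negz n.+1 + 1 = Negz n by lia.
  rewrite [X in _ === X ++ _]/zpow nseqSr -catA.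
  have := ge_free (nseq n.+1 (g, false)) [::] (g, false).
  by rewrite cats0 => H; symmetry.
Qed.

Lemma zpowP g z : zpow g (z - 1) === zpow g z ++ [:: (g, false)].
Proof.
have := zpowS g (z - 1); rewrite subrK => ->.
have := ge_free (zpow g (z - 1)) [::] (g, true).
by rewrite cats0 -catA => H; symmetry.
Qed.

Lemma zpowD g y z : zpow g (y + z) === zpow g y ++ zpow g z.
Proof.
elim/int_rect: z => [|n IH|n IH].
- by rewrite addr0 cats0; reflexivity.
- have -> : n.+1 = n%:Z + 1 :> int by lia.
  by rewrite addrA !zpowS IH catA; reflexivity.
- have -> : - n.+1%:Z = - n%:Z - 1 :> int by lia.
  by rewrite addrA !zpowP IH catA; reflexivity.
Qed.

Lemma commutes_zpow u g z : commutes u [:: (g, false)] -> commutes u (zpow g z).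
Proof.
move=> H; have H' : commutes u [:: (g, true)] by exact: (commutes_winv H).
have Hn b n : commutes u (nseq n (g, b)).
  elim: n => [|n IH]; first exact: commutes_nil.
  by rewrite nseqSr; apply: commutes_cat => //; case: b {IH}.
by case: z => n; apply: Hn.
Qed.

Lemma posD c d : pos (c + d) === pos c ++ pos d.
Proof.
rewrite /pos /= !zpowD -!catA.
have H : commutes (zpow gs c.2) (zpow gt d.1).
  apply: commutes_zpow; apply: commutes_sym; apply: commutes_zpow.
  exact/commutes_sym/rel_st.
by rewrite (catA (zpow gs c.2)) H -catA; reflexivity.
Qed.

(** * Lamps are commuting involutions *)

Lemma lamp_shift c d : lamp (c + d) === pos c ++ lamp d ++ winv (pos c).
Proof.
rewrite /lamp posD winv_cat; move: (pos c) (pos d) => p q.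
by rewrite -!catA; reflexivity.
Qed.

Lemma lamp_sq c : lamp c ++ lamp c === [::].
Proof.
rewrite /lamp; move: (pos c) => p; rewrite -!catA catKw (catA A A) rel_aa /= catwV; reflexivity.
Qed.

(** The relation a^s = a a^t moved to position (i, j): multiplying x^i (1+x)^j by 1 + x splits it
    into two monomials. *)
Lemma lamp_rel i j : lamp (i, j + 1) === lamp (i, j) ++ lamp (i + 1, j).
Proof.
have -> : (i, j + 1) = (i, j) + (0, 1) by congr pair; rewrite /= addr0.
have -> : (i + 1, j) = (i, j) + (1, 0) by congr pair; rewrite /= addr0.
have H : lamp (0, 1) === A ++ lamp (1, 0) by exact: rel_as.
rewrite !lamp_shift H {2}/lamp; move: (pos (i, j)) (lamp _) => p l.
by rewrite -!catA catKw; reflexivity.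
Qed.

Lemma commutes_lamp_shift c d e :
  commutes (lamp d) (lamp e) -> commutes (lamp (c + d)) (lamp (c + e)).
Proof. by rewrite !lamp_shift; apply: commutes_conj. Qed.

(* Baumslag's trick: conjugating [m_0, m_k] = 1 by s gives
   [m_0 m_1, m_k m_(k+1)] = 1, hence [m_0, m_(k+1)] = 1. *)
Lemma commutes_lamp_row (k : nat) : commutes (lamp 0) (lamp (k%:Z, 0)).
Proof.
elim/ltn_ind: k => -[_|[_|k IH]].
- by rewrite /commutes; reflexivity.
- have -> : lamp (1, 0) = conj A T by [].
  have -> : lamp 0 = A by [].
  exact: rel_at.
have H0 : commutes (lamp 0) (lamp (k.+1%:Z, 0)) by apply: IH.
have H1 : commutes (lamp (1, 0)) (lamp (k.+1%:Z, 0)).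
  have := @commutes_lamp_shift (1, 0) 0 (k%:Z, 0) (IH k (leqW (ltnSn _))).
  by rewrite addr0 (_ : (1, 0) + (k%:Z, 0) = (k.+1%:Z, 0)).
have H2 : commutes (lamp (1, 0)) (lamp (k.+2%:Z, 0)).
  have := @commutes_lamp_shift (1, 0) 0 (k.+1%:Z, 0) (IH k.+1 (ltnSn _)).
  by rewrite addr0 (_ : (1, 0) + (k.+1%:Z, 0) = (k.+2%:Z, 0)).
have := @commutes_lamp_shift (0, 1) _ _ H0.
have -> : (0, 1) + 0 = (0, 0 + 1) :> (int * int)%type by [].
have -> : (0, 1) + (k.+1%:Z, 0) = (k.+1%:Z, 0 + 1) :> (int * int)%type by [].
rewrite !lamp_rel add0r.
have -> : k.+1%:Z + 1 = k.+2%:Z by lia.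
rewrite -[lamp (0, 0)]/(lamp 0).
move: H0 H1 H2; rewrite /commutes.
move: (lamp 0) (lamp (1, 0)) (lamp (k.+1%:Z, 0)) (lamp (k.+2%:Z, 0)).
move=> m0 m1 mk mk' H0 H1 H2.
(* The three known commutations make both sides begin with [mk] and end with [m1]; cancelling these
   leaves the new commutation. *)
rewrite -!catA (catA m1 mk) H1 -catA H2 (catA m0 mk) H0 -catA.
move/gequiv_cancell; rewrite (catA m0) (catA mk').
exact: gequiv_cancelr.
Qed.

(** A lamp in row j + 1 is a product of two lamps in row j, so the base row gives all rows j >= 0.
    Translating by -d and using symmetry passes from d to -d. *)
Lemma commutes_lamp0 c : commutes (lamp 0) (lamp c).
Proof.
have Hs d : commutes (lamp 0) (lamp d) -> commutes (lamp 0) (lamp (- d)).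
  move/(@commutes_lamp_shift (- d)); rewrite addr0 addNr; exact: commutes_sym.
have Hn (j : nat) i : commutes (lamp 0) (lamp (i, j%:Z)).
  elim: j i => [|j IH] i.
    case: i => n; first exact: commutes_lamp_row.
    have -> : (Negz n, 0%:Z) = - (n.+1%:Z, 0) by [].
    exact/Hs/commutes_lamp_row.
  have -> : j.+1%:Z = j%:Z + 1 by lia.
  by rewrite lamp_rel; apply: commutes_cat.
case: c => i [j|j]; first exact: Hn.
have -> : (i, Negz j) = - (- i, j.+1%:Z) by congr pair; rewrite /= opprK.
exact/Hs/Hn.
Qed.

Lemma commutes_lamp c d : commutes (lamp c) (lamp d).
Proof.
have := @commutes_lamp_shift c _ _ (commutes_lamp0 (d - c)).
by rewrite addr0 addrC subrK.
Qed.

(** * Lamp configurations and their spans *)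

Definition lamps (L : seq (int * int)) : word := flatten (map lamp L).

Lemma lamps_cat L L' : lamps (L ++ L') = lamps L ++ lamps L'.
Proof. by rewrite /lamps map_cat flatten_cat. Qed.

Lemma lamps_cons c L : lamps (c :: L) = lamp c ++ lamps L.
Proof. by []. Qed.

(** Only the parity of the number of occurrences of [c] in [L] matters, and [b] is that parity. *)
Lemma lamps_extract c L : exists b : bool,
  lamps L === (if b then lamp c else [::]) ++ lamps [seq d <- L | d != c].
Proof.
elim: L => [|d L [b IH]]; first by exists false; reflexivity.
rewrite /= !lamps_cons; case: eqVneq => [->|Hd] /=.
  case: b IH => IH; [exists false|exists true]; rewrite IH.
    by rewrite catA lamp_sq; reflexivity.
  by reflexivity.
exists b; rewrite lamps_cons IH; case: b {IH} => /=; last by reflexivity.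
by rewrite (catA (lamp d)) (commutes_lamp d c) -catA; reflexivity.
Qed.

(** As lamps commute and square to 1, this is the F_2-linear span of the monomials at [V]. *)
Definition lspan (V : pred (int * int)) (w : word) :=
  exists2 L, {subset L <= V} & w === lamps L.

Lemma lspan_lamp (V : pred (int * int)) c : V c -> lspan V (lamp c).
Proof.
move=> Vc; exists [:: c]; first by move=> d; rewrite inE => /eqP->.
by rewrite /lamps /= cats0; reflexivity.
Qed.

Lemma lspan_cat V u v : lspan V u -> lspan V v -> lspan V (u ++ v).
Proof.
move=> [L HL Lu] [L' HL' Lv]; exists (L ++ L').
  by move=> c; rewrite mem_cat => /orP[/HL|/HL'].
by rewrite lamps_cat Lu Lv; reflexivity.
Qed.

Lemma lspan_gequiv V u v : u === v -> lspan V v -> lspan V u.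
Proof. by move=> H [L HL Lu]; exists L => //; rewrite H. Qed.

Lemma lspan_lamps (V V' : pred (int * int)) L : {subset L <= V} ->
  (forall c, V c -> lspan V' (lamp c)) -> lspan V' (lamps L).
Proof.
move=> HL HV; elim: L HL => [|c L IH] HL.
  by exists [::] => //; reflexivity.
rewrite lamps_cons; apply: lspan_cat; first by apply/HV/HL; rewrite inE eqxx.
by apply: IH => d Hd; apply: HL; rewrite inE Hd orbT.
Qed.

(** * Tripods span triangles *)

Definition triangle (n : nat) (c : int * int) :=
  [&& - n%:Z <= c.1, - n%:Z <= c.2 & c.1 + c.2 <= n%:Z].

(** Abstracts [lamp_rel]: three monomials with sum 0 over F_2, any two of which determine the
    third. *)
Definition two_of_three (P : int -> int -> Prop) := forall i j,
  [/\ P i j -> P (i + 1) j -> P i (j + 1),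
      P i (j + 1) -> P (i + 1) j -> P i j
    & P i (j + 1) -> P i j -> P (i + 1) j].

(** This is the symmetry exchanging x and 1 + x; it yields the second tripod. *)
Lemma two_of_three_swap P : two_of_three P -> two_of_three (fun i j => P j i).
Proof. by move=> H i j; have [H1 H2 H3] := H j i; split=> *; auto. Qed.

(** To the right of the central column, each point follows from two points of the preceding column.
    To the left, each new column is seeded by its point on the row 0 and is filled upwards and
    downwards from there. *)
Lemma triangle_closure (n : nat) P : two_of_three P ->
  (forall k : nat, (k <= n)%N -> P (- k%:Z) 0) ->
  (forall k : nat, (k <= n)%N -> P 0 (- k%:Z) /\ P 0 k%:Z) ->
  forall i j : int, - n%:Z <= i -> - n%:Z <= j -> i + j <= n%:Z -> P i j.
Proof.
move=> HP Hrow Hcol.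
have Hcol' (j : int) : - n%:Z <= j -> j <= n%:Z -> P 0 j.
  case: j => k Hk1 Hk2; first by apply (Hcol k); lia.
  by rewrite NegzE; apply (Hcol k.+1); lia.
have Hpos (i : nat) (j : int) : - n%:Z <= j -> i%:Z + j <= n%:Z -> P i%:Z j.
  elim: i j => [|i IH] j Hj Hij; first by apply: Hcol'; lia.
  have -> : i.+1%:Z = i%:Z + 1 by lia.
  by have [_ _] := HP i j; apply; apply: IH; lia.
have Hneg (i : nat) (j : int) : (i <= n)%N -> - n%:Z <= j -> - i%:Z + j <= n%:Z ->
    P (- i%:Z) j.
  elim: i j => [|i IH] j Hi Hj Hij; first by apply: Hcol'; lia.
  have HI (k : int) : - n%:Z <= k -> - i%:Z + k <= n%:Z -> P (- i.+1%:Z + 1) k.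
    have -> : - i.+1%:Z + 1 = - i%:Z by lia.
    by move=> *; apply: IH => //; lia.
  elim/int_rect: j Hj Hij => [|j IHj|j IHj] Hj Hij; first exact: Hrow.
  - have -> : j.+1%:Z = j%:Z + 1 by lia.
    by have [+ _ _] := HP (- i.+1%:Z) j%:Z; apply; [apply: IHj|apply: HI]; lia.
  - have [_ + _] := HP (- i.+1%:Z) (- j.+1%:Z); apply; last by apply: HI; lia.
    have -> : - j.+1%:Z + 1 = - j%:Z by lia.
    by apply: IHj; lia.
case=> i j Hi Hj Hij; first exact: Hpos.
by rewrite NegzE; apply: Hneg; lia.
Qed.

Lemma lspan_two_of_three V : two_of_three (fun i j => lspan V (lamp (i, j))).
Proof.
move=> i j; split=> H1 H2; have Hr := lamp_rel i j.
- by apply: lspan_gequiv Hr _; apply: lspan_cat.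
- apply: (@lspan_gequiv _ _ (lamp (i, j + 1) ++ lamp (i + 1, j))).
    by rewrite Hr -catA lamp_sq cats0; reflexivity.
  exact: lspan_cat.
- apply: (@lspan_gequiv _ _ (lamp (i, j) ++ lamp (i, j + 1))).
    by rewrite Hr catA lamp_sq; reflexivity.
  exact: lspan_cat.
Qed.

(** * Walks in the square lattice *)

Definition step (c d : int * int) := `|d.1 - c.1| + `|d.2 - c.2| == 1.

(** The start counts as visited only if the walk returns to it, because lamps will be switched on
    arrival. *)
Definition walk (c d : int * int) (k : nat) (V : pred (int * int)) :=
  exists ps, [/\ path step c ps, last c ps = d, (size ps <= k)%N & {subset V <= ps}].

Lemma walk_cat c d e k l V W :
  walk c d k V -> walk d e l W -> walk c e (k + l) (predU V W).
Proof.
move=> [p [Hp <- Hk HV]] [q [Hq <- Hl HW]]; exists (p ++ q); split.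
- by rewrite cat_path Hp.
- by rewrite last_cat.
- by rewrite size_cat leq_add.
- by move=> x; rewrite mem_cat => /orP[/HV->|/HW->]; rewrite ?orbT.
Qed.

Lemma walk_le c d k l V W : (k <= l)%N -> {subset W <= V} ->
  walk c d k V -> walk c d l W.
Proof.
move=> Hkl HWV [p [Hp Hd Hk HV]]; exists p; split=> //.
  exact: leq_trans Hkl.
by move=> x /HWV/HV.
Qed.

Definition ray (c v : int * int) (k : nat) : pred (int * int) :=
  fun x => has (fun m => x == c + v *+ m) (iota 1 k).

Lemma walk_ray c v k : step 0 v -> walk c (c + v *+ k) k (ray c v k).
Proof.
move=> Hv; elim: k => [|k [p [Hp Hl Hk HV]]].
  by exists [::]; rewrite addr0.
exists (rcons p (c + v *+ k.+1)); split.
- rewrite rcons_path Hp Hl /= mulrSr addrA.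
  by move: Hv (c + _) => + e; rewrite /step /=; lia.
- by rewrite last_rcons.
- by rewrite size_rcons.
- have Hi : iota 1 k.+1 = rcons (iota 1 k) k.+1.
    by rewrite -cats1 -{1}(addn1 k) iotaD add1n.
  move=> x; rewrite mem_rcons inE -topredE /= /ray Hi has_rcons.
  by case/orP=> [->//|H]; rewrite [x \in p]HV ?orbT.
Qed.

Lemma walk_to c d : walk c d (absz (d.1 - c.1) + absz (d.2 - c.2)) pred0.
Proof.
move Hk: (_ + _)%N => k; elim: k c Hk => [|k IH] [i j] /= Hk.
  by exists [::]; split=> //=; case: d Hk => x y /= Hk; congr pair; lia.
suff [e He Hd] : exists2 e, step (i, j) e
    & (absz (d.1 - e.1) + absz (d.2 - e.2) = k)%N.
  have [p [Hp Hl Hs _]] := IH e Hd.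
  by exists (e :: p); split=> //=; rewrite He.
rewrite /step; case: d Hk {IH} => x y /= Hk.
have [H|H|H] := ltgtP i x; [exists (i + 1, j)|exists (i - 1, j)|];
  rewrite /=; [lia..|].
by have [H'|H'|H'] := ltgtP j y; [exists (i, j + 1)|exists (i, j - 1)|];
  rewrite /=; lia.
Qed.

Definition tripod (n : nat) (u v w : int * int) : pred (int * int) :=
  fun c => has (fun m => [|| c == u *+ m, c == v *+ m | c == w *+ m]) (iota 0 n.+1).

(* Walk out and back along two arms, out along the third, and on to [d]. *)
Lemma walk_tripod (n : nat) u v w d : (0 < n)%N ->
  step 0 u -> step 0 v -> step 0 w ->
  (absz (d.1 - (w *+ n).1) + absz (d.2 - (w *+ n).2) <= n)%N ->
  walk 0 d (6 * n) (tripod n u v w).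
Proof.
move=> n0 Hu Hv Hw Hd.
have Hopp x : step 0 x -> step 0 (- x) by rewrite /step /=; lia.
have Hback x : step 0 x -> walk (x *+ n) 0 n (ray (x *+ n) (- x) n).
  by move/Hopp/(walk_ray (x *+ n) n); rewrite mulNrn subrr.
have Hout x : step 0 x -> walk 0 (x *+ n) n (ray 0 x n).
  by move/(walk_ray 0 n); rewrite add0r.
have W := walk_cat (walk_cat (walk_cat (walk_cat (Hout u Hu) (Hback u Hu))
  (walk_cat (Hout v Hv) (Hback v Hv))) (Hout w Hw)) (walk_to (w *+ n) d).
(* The cost is 2n for each of the first two arms, n for the third, and at most n from its tip to
   [d]. *)
apply: walk_le W; first by apply: leq_trans (leq_add (leqnn _) Hd) _; lia.
have Hray x m : (0 < m <= n)%N -> ray 0 x n (x *+ m).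
  move=> Hm; apply/hasP; exists m; rewrite ?add0r //.
  by rewrite mem_iota; lia.
move=> c /hasP[[|m]]; rewrite mem_iota => Hm.
  (* The centre is not on an outgoing ray; it is visited on returning along the first arm. *)
  rewrite !mulr0n !orbb => /eqP->; rewrite -topredE /=.
  have -> : ray (u *+ n) (- u) n 0; last by rewrite orbT.
  apply/hasP; exists n; last by rewrite mulNrn subrr.
  by rewrite mem_iota; lia.
rewrite -topredE /=.
have Hm' : (0 < m.+1 <= n)%N by lia.
by case/or3P=> /eqP->; rewrite (Hray _ _ Hm') ?orbT.
Qed.

Lemma tripod_arm n u v w (k : nat) : (k <= n)%N ->
  [/\ tripod n u v w (u *+ k), tripod n u v w (v *+ k) & tripod n u v w (w *+ k)].
Proof.
move=> Hk; have Hi : k \in iota 0 n.+1 by rewrite mem_iota; lia.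
by split; apply/hasP; exists k => //; rewrite eqxx ?orbT.
Qed.

(** * From walks to words: the upper bound on length *)

Definition letter_shift (x : letter) : int * int :=
  match x.1 with
  | ga => 0
  | gs => (0, if x.2 then 1 else -1)
  | gt => (if x.2 then 1 else -1, 0)
  end.

Lemma pos_letter x c : x.1 <> ga -> pos c ++ [:: x] === pos (c + letter_shift x).
Proof. by rewrite posD; case: x => -[] [] //= _; reflexivity. Qed.

Lemma step_letter c d : step c d -> exists2 x : letter, x.1 <> ga & d = c + letter_shift x.
Proof.
case: c d => i j [k l]; rewrite /step /= => H.
have [[-> ->]|[[-> ->]|[[-> ->]|[-> ->]]]] : k = i /\ l = j + 1 \/ k = i /\ l = j - 1 \/
    k = i + 1 /\ l = j \/ k = i - 1 /\ l = j by lia.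
- by exists (gs, true) => //; congr pair; rewrite /= addr0.
- by exists (gs, false) => //; congr pair; rewrite /= addr0.
- by exists (gt, true) => //; congr pair; rewrite /= addr0.
- by exists (gt, false) => //; congr pair; rewrite /= addr0.
Qed.

Lemma lamp_pos c : lamp c ++ pos c === pos c ++ A.
Proof.
rewrite /lamp; move: (pos c) => p.
by rewrite -!catA catVw cats0; reflexivity.
Qed.

(** The generating set makes lamp switching free: s^-1 a = (as)^-1, sa, t^-1 a = (at)^-1 and ta each
    count as one letter. *)
Lemma step_agen c d (b : bool) : step c d -> exists y : agen * bool,
  pos c ++ aeval [:: y] === (if b then lamp d else [::]) ++ pos d.
Proof.
case/step_letter=> x Hx ->.
have [y Hy] : exists y : agen * bool, aeval [:: y] === x :: (if b then A else [::]).
  case: x Hx => -[] [] // _; case: b;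
    [exists (Xas, true)|exists (Xs, true)|exists (Xsa, false)|exists (Xs, false)
    |exists (Xat, true)|exists (Xt, true)|exists (Xta, false)|exists (Xt, false)];
    try reflexivity.
  - exact: (gequiv_catl [:: (gs, true)] winvA).
  - exact: (gequiv_catl [:: (gt, true)] winvA).
exists y; rewrite Hy -cat1s catA pos_letter //.
case: b {Hy}; last by rewrite cats0; reflexivity.
by rewrite lamp_pos; reflexivity.
Qed.

Lemma aeval_cons y u : aeval (y :: u) = aeval [:: y] ++ aeval u.
Proof. by rewrite /aeval /= cats0. Qed.

(** Each lamp is settled at the first visit to its position; the rest of the walk serves the other
    lamps. *)
Lemma walk_aword ps c L : path step c ps -> {subset L <= ps} ->
  exists2 u : seq (agen * bool), size u = size ps
    & pos c ++ aeval u === lamps L ++ pos (last c ps).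
Proof.
elim: ps c L => [|d ps IH] c L /=.
  case: L => [|x L] _ HL; last by have := HL x; rewrite inE eqxx => /(_ isT).
  by exists [::] => //; rewrite cats0; reflexivity.
case/andP=> Hcd Hps HL; have [b Hb] := lamps_extract d L.
have [|u Hu Eu] := IH d [seq e <- L | e != d] Hps.
  move=> e; rewrite mem_filter => /andP[Hed /HL].
  by rewrite inE (negPf Hed).
have [y Hy] := step_agen b Hcd.
exists (y :: u); first by rewrite /= Hu.
by rewrite aeval_cons catA Hy -catA Eu catA -Hb; reflexivity.
Qed.

Definition ball (k : nat) (c : int * int) := `|c.1| + `|c.2| <= k%:Z.

(** Reading from the left, a letter [a] adds a lamp at the current position and any other letter
    moves that position by one. *)
Lemma word_normal_form w : exists L d,
  [/\ w === lamps L ++ pos d, {subset L <= ball (size w)} & ball (size w) d].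
Proof.
elim/last_ind: w => [|w x [L [d [Hw HL Hd]]]].
  by exists [::], 0; split=> //; reflexivity.
have Hb c : ball (size w) c -> ball (size w).+1 c by rewrite /ball; lia.
rewrite size_rcons -cats1; case: x => g b.
have [Eg|Ng] : g = ga \/ g <> ga by case: g; [left|right|right].
- exists (rcons L d), d; split; last exact: Hb.
    have HA : [:: (g, b)] === A.
      by rewrite Eg; case: b; [exact: winvA|reflexivity].
    have E1 : lamps [:: d] = lamp d by rewrite /lamps /= cats0.
    rewrite HA Hw -cats1 lamps_cat E1 -(catA _ (pos d)) -(catA _ (lamp d)).
    by rewrite lamp_pos; reflexivity.
  move=> c; rewrite mem_rcons inE => /orP[/eqP->|/HL]; exact: Hb.
- exists L, (d + letter_shift (g, b)); split.
  + by rewrite Hw -catA pos_letter //; reflexivity.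
  + by move=> c /HL; apply: Hb.
  + by move: Hd; rewrite /ball; case: g Ng; case: b; rewrite //= => _; lia.
Qed.

Lemma dist_le_tripod (n : nat) u v w L d : (0 < n)%N ->
  step 0 u -> step 0 v -> step 0 w ->
  (absz (d.1 - (w *+ n).1) + absz (d.2 - (w *+ n).2) <= n)%N ->
  {subset L <= triangle n} ->
  (forall c, triangle n c -> lspan (tripod n u v w) (lamp c)) ->
  dist_le [::] (lamps L ++ pos d) (6 * n).
Proof.
move=> n0 Hu Hv Hw Hd HL HV.
have [ps [Hps Hl Hs Hsub]] := walk_tripod n0 Hu Hv Hw Hd.
have [L' HL' EL] := lspan_lamps HL HV.
have [|x Hx Ex] := @walk_aword ps 0 L' Hps; first by move=> c /HL'/Hsub.
exists x; split; first by rewrite Hx.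
by rewrite EL -Hl -Ex; reflexivity.
Qed.

Lemma dist_le_triangle (n : nat) L d : (0 < n)%N ->
  {subset L <= triangle n} -> ball n d ->
  dist_le [::] (lamps L ++ pos d) (6 * n).
Proof.
move=> n0 HL Hd.
have E1 (k : nat) : (- k%:Z, 0) = (-1, 0) *+ k :> (int * int)%type.
  by rewrite pairMnE /= mul0rn mulNrn natz.
have E2 (k : nat) : (0, - k%:Z) = (0, -1) *+ k :> (int * int)%type.
  by rewrite pairMnE /= mul0rn mulNrn natz.
have E3 (k : nat) : (k%:Z, 0) = (1, 0) *+ k :> (int * int)%type.
  by rewrite pairMnE /= mul0rn natz.
have E4 (k : nat) : (0, k%:Z) = (0, 1) *+ k :> (int * int)%type.
  by rewrite pairMnE /= mul0rn natz.
have Hl u v w (k : nat) : (k <= n)%N ->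
    [/\ lspan (tripod n u v w) (lamp (u *+ k)),
        lspan (tripod n u v w) (lamp (v *+ k))
      & lspan (tripod n u v w) (lamp (w *+ k))].
  by move=> Hk; have [? ? ?] := tripod_arm u v w Hk; split; apply: lspan_lamp.
have HV1 V : (forall k : nat, (k <= n)%N -> [/\ lspan V (lamp (- k%:Z, 0)),
    lspan V (lamp (0, - k%:Z)) & lspan V (lamp (0, k%:Z))]) ->
    forall c, triangle n c -> lspan V (lamp c).
  move=> HV [i j] /and3P[/= Hi Hj Hij].
  apply: (triangle_closure (lspan_two_of_three V)) Hi Hj Hij => k /HV[] //.
(* The mirror tripod supplies an arm in direction (1, 0), absent from the first one. *)
have HV2 V : (forall k : nat, (k <= n)%N -> [/\ lspan V (lamp (0, - k%:Z)),
    lspan V (lamp (- k%:Z, 0)) & lspan V (lamp (k%:Z, 0))]) ->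
    forall c, triangle n c -> lspan V (lamp c).
  move=> HV [i j] /and3P[/= Hi Hj Hij]; rewrite addrC in Hij.
  have H3 := two_of_three_swap (lspan_two_of_three V).
  by apply: (triangle_closure H3) Hj Hi Hij => k /HV[].
(* The cone containing [d] selects the last arm: if, say, |d.1| <= d.2, the tip (0, n) is at
   distance |d.1| + n - d.2 <= n from [d]. *)
have Hcase : `|d.1| <= d.2 \/ `|d.1| <= - d.2 \/ `|d.2| <= - d.1 \/ `|d.2| <= d.1 by lia.
case: d Hd Hcase => p q; rewrite /ball /= => Hd.
case=> [H|[H|[H|H]]].
- apply: (@dist_le_tripod n (-1, 0) (0, -1) (0, 1)) => //.
    by rewrite -E4 /=; lia.
  by apply: HV1 => k /(Hl (-1, 0) (0, -1) (0, 1)); rewrite E1 E2 E4.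
- apply: (@dist_le_tripod n (-1, 0) (0, 1) (0, -1)) => //.
    by rewrite -E2 /=; lia.
  by apply: HV1 => k /(Hl (-1, 0) (0, 1) (0, -1)); rewrite E1 E2 E4 => -[].
- apply: (@dist_le_tripod n (0, -1) (0, 1) (-1, 0)) => //.
    by rewrite -E1 /=; lia.
  by apply: HV1 => k /(Hl (0, -1) (0, 1) (-1, 0)); rewrite E1 E2 E4 => -[].
- apply: (@dist_le_tripod n (0, -1) (-1, 0) (1, 0)) => //.
    by rewrite -E3 /=; lia.
  by apply: HV2 => k /(Hl (0, -1) (-1, 0) (1, 0)); rewrite E1 E2 E3.
Qed.

(** * The projection to Z^2 and the trace of a word *)

Fixpoint tot (w : word) : int * int :=
  if w is x :: w' then letter_shift x + tot w' else 0.

Lemma tot_cat u v : tot (u ++ v) = tot u + tot v.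
Proof. by elim: u => [|x u IH] /=; rewrite ?add0r // IH addrA. Qed.

Lemma tot_free x : tot [:: x; linv x] = 0.
Proof. by case: x => -[] []. Qed.

Lemma tot_rel r : List.In r relators -> tot r = 0.
Proof. by move=> /= [<-|[<-|[<-|[<-|[]]]]]. Qed.

Lemma tot_gequiv u v : u === v -> tot u = tot v.
Proof.
elim=> {u v} [//|//|u v w _ -> _ -> //|p q x|p q r Hr].
- by rewrite -[_ :: _]/([:: x; linv x] ++ q) !tot_cat tot_free add0r.
- by rewrite !tot_cat (tot_rel Hr) add0r.
Qed.

Lemma tot_pos c : tot (pos c) = c.
Proof.
have Hn x n : tot (nseq n x) = letter_shift x *+ n.
  by elim: n => [|n IH] /=; rewrite ?mulr0n // IH mulrS.
case: c => i j; rewrite /pos tot_cat /=.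
have -> : tot (zpow gt i) = (i, 0).
  by case: i => n; rewrite Hn pairMnE /= mul0rn ?mulNrn natz.
have -> : tot (zpow gs j) = (0, j).
  by case: j => n; rewrite Hn pairMnE /= mul0rn ?mulNrn natz.
by congr pair; rewrite /= ?addr0 ?add0r.
Qed.

Lemma tot_lamp c : tot (lamp c) = 0.
Proof.
have := tot_gequiv (catwV (pos c)); rewrite /lamp !tot_cat => H.
by rewrite addrCA H.
Qed.

Lemma tot_lamps L : tot (lamps L) = 0.
Proof. by elim: L => [//|c L IH]; rewrite lamps_cons tot_cat tot_lamp IH. Qed.

Definition ashift (y : agen * bool) := tot (aeval [:: y]).

Lemma ball_ashift y : ball 1 (ashift y).
Proof. by case: y => -[] []. Qed.

Definition trace (c : int * int) (u : seq (agen * bool)) : seq (int * int) :=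
  scanl (fun d y => d + ashift y) c u.

Lemma last_trace c u : last c (trace c u) = c + tot (aeval u).
Proof.
elim: u c => [|y u IH] c; first by rewrite addr0.
by rewrite aeval_cons tot_cat addrA -IH.
Qed.

(** * Evaluation in a field of characteristic 2 *)

Section Model.

Variables (K : fieldType) (al : K).
Hypotheses (al_neq0 : al != 0) (al1_neq0 : 1 + al != 0) (K2 : 2 = 0 :> K).

Definition mono (c : int * int) : K := al ^ c.1 * (1 + al) ^ c.2.

Lemma monoD c d : mono (c + d) = mono c * mono d.
Proof. by rewrite /mono /= !expfzDr // mulrACA. Qed.

Lemma mono0 : mono 0 = 1.
Proof. by rewrite /mono /= !expr0z mulr1. Qed.

(** The lamp component of a word under x := [al]. By [ev_cat] it is a crossed homomorphism, with
    [tot] acting through [mono]. *)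
Fixpoint ev (w : word) : K :=
  if w is x :: w' then (if x.1 is ga then 1 else 0) + mono (letter_shift x) * ev w'
  else 0.

Lemma ev_cat u v : ev (u ++ v) = ev u + mono (tot u) * ev v.
Proof.
elim: u => [|x u IH] /=; first by rewrite mono0 mul1r add0r.
by rewrite IH monoD mulrDr mulrA addrA.
Qed.

Lemma ev_free x : ev [:: x; linv x] = 0.
Proof.
case: x => -[] b; rewrite /= /letter_shift /= !(mulr0, addr0) //.
by rewrite mono0 mulr1; exact: K2.
Qed.

Lemma ev_rel r : List.In r relators -> ev r = 0.
Proof.
(* Before reduction modulo 2 the relators evaluate to 2, 2(1 + al), 0 and 2(1 + al); the zero is
   rewritten in this form for [ring] and [field]. *)
have H x : 2 * x = 0 :> K by rewrite K2 mul0r.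
have E i j : mono (i, j) = al ^ i * (1 + al) ^ j by [].
move=> /= [<-|[<-|[<-|[<-|[]]]]]; rewrite /= /letter_shift /= ?mono0 ?E ?expr0z ?expr1z ?exprN1.
- by rewrite -[RHS](H 1); ring.
- by rewrite -[RHS](H (1 + al)); field; rewrite al_neq0.
- by ring.
- by rewrite -[RHS](H (1 + al)); field; rewrite al_neq0.
Qed.

Lemma ev_gequiv u v : u === v -> ev u = ev v.
Proof.
elim=> {u v} [//|//|u v w _ -> _ -> //|p q x|p q r Hr].
- rewrite -[_ :: _]/([:: x; linv x] ++ q) !ev_cat ev_free tot_free.
  by rewrite mono0 add0r mul1r.
- by rewrite !ev_cat (ev_rel Hr) (tot_rel Hr) mono0 add0r mul1r.
Qed.

Lemma ev_lamp c : ev (lamp c) = mono c.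
Proof.
have Hn x n : x.1 <> ga -> ev (nseq n x) = 0.
  case: x => -[] b Hx; [by case: Hx| |];
    by elim: n => [//|n /= ->]; rewrite mulr0 addr0.
have Hz g z : g <> ga -> ev (zpow g z) = 0 by case: z => n Hg; apply: Hn.
have H0 : ev (pos c) = 0 by rewrite /pos ev_cat !Hz // mulr0 addr0.
have mono_neq0 : mono c != 0 by rewrite mulf_neq0 // expfz_neq0.
have HV : ev (winv (pos c)) = 0.
  have := ev_gequiv (catwV (pos c)); rewrite ev_cat H0 add0r tot_pos.
  by move/eqP; rewrite mulf_eq0 (negPf mono_neq0) => /eqP.
by rewrite /lamp ev_cat H0 tot_pos (ev_cat A) HV /= !(mulr0, addr0, add0r, mulr1).
Qed.

Lemma ev_lamps L : ev (lamps L) = \sum_(c <- L) mono c.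
Proof.
elim: L => [|c L IH]; first by rewrite big_nil.
by rewrite lamps_cons ev_cat tot_lamp mono0 mul1r ev_lamp IH big_cons.
Qed.

(** A generator carries [a] only before or after its move, so it affects lamps only at the two ends
    of its step. *)
Lemma ev_agen y : exists b b' : bool,
  ev (aeval [:: y]) = b%:R + b'%:R * mono (ashift y).
Proof.
have H0 b : letter_shift (ga, b) = 0 by [].
rewrite /ashift; case: y => -[] [];
  [exists true, false|exists true, false
  |exists false, false|exists false, false
  |exists false, false|exists false, false
  |exists false, true|exists true, false
  |exists true, false|exists false, true
  |exists true, true|exists true, true
  |exists false, true|exists true, false
  |exists true, false|exists false, true
  |exists true, true|exists true, true];
rewrite /= ?H0 ?mono0 ?addr0 ?add0r ?mulr0 ?mul1r ?mul0r ?addr0 ?add0r ?mulr1 //.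
Qed.

(** By [ev_agen] the value is a sum of monomials at visited positions. The predicate [I] will
    express vanishing at 0 beyond a given order. *)
Lemma ev_trace (I : K -> Prop) c u : I 0 -> (forall x y, I x -> I y -> I (x + y)) ->
  (forall d, d \in c :: trace c u -> I (mono d)) -> I (mono c * ev (aeval u)).
Proof.
move=> I0 ID; elim: u c => [|y u IH] c HI; first by rewrite mulr0.
have Hb (b : bool) d : d \in c :: trace c (y :: u) -> I (b%:R * mono d).
  by case: b => Hd; rewrite ?mul1r ?mul0r //; apply: HI.
rewrite aeval_cons ev_cat mulrDr mulrA -monoD; apply: (ID).
  have [b [b' ->]] := ev_agen y.
  rewrite mulrDr mulrCA -monoD mulrC; apply: (ID); apply: Hb.
    by rewrite inE eqxx.
  by rewrite /= !inE eqxx orbT.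
by apply: IH => d Hd; apply: HI; rewrite inE Hd orbT.
Qed.

End Model.

(** * Local behaviour of rational functions over F_2 *)

Definition ratF2 : fieldType := {fraction {poly 'F_2}}.

Definition zF2 : ratF2 := tofrac 'X.

(* [residue f r]: the rational function f is regular at 0, with value r. *)
Definition residue (f : ratF2) (r : 'F_2) := exists p q : {poly 'F_2},
  [/\ q.[0] = 1, p.[0] = r & f * tofrac q = tofrac p].

Lemma residue_poly (p : {poly 'F_2}) : residue (tofrac p) p.[0].
Proof. by exists p, 1; rewrite hornerC rmorph1 mulr1. Qed.

Lemma residueD f g r s : residue f r -> residue g s -> residue (f + g) (r + s).
Proof.
move=> [p [q [Hq Hp E]]] [p' [q' [Hq' Hp' E']]].
exists (p * q' + p' * q), (q * q'); rewrite !hornerE Hq Hp Hq' Hp' !mulr1.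
by split=> //; rewrite rmorphD !rmorphM /= -E -E'; ring.
Qed.

Lemma residueM f g r s : residue f r -> residue g s -> residue (f * g) (r * s).
Proof.
move=> [p [q [Hq Hp E]]] [p' [q' [Hq' Hp' E']]].
exists (p * p'), (q * q'); rewrite !hornerE Hq Hp Hq' Hp' !mulr1.
by split=> //; rewrite !rmorphM /= -E -E'; ring.
Qed.

Lemma residueV f : residue f 1 -> residue f^-1 1.
Proof.
move=> [p [q [Hq Hp E]]]; exists q, p; split=> //.
have : tofrac p != 0.
  by rewrite tofrac_eq0; apply: contra_eq_neq Hp => ->; rewrite hornerC eq_sym oner_neq0.
rewrite -E mulf_eq0 => /norP[f0 _].
by rewrite mulKf.
Qed.

Lemma residue_uniq f r s : residue f r -> residue f s -> r = s.
Proof.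
move=> [p [q [Hq Hp E]]] [p' [q' [Hq' Hp' E']]].
have : tofrac (p * q') = tofrac (p' * q) by rewrite !rmorphM /= -E -E'; ring.
move/eqP; rewrite tofrac_eq => /eqP/(congr1 (fun u => u.[0])).
by rewrite !hornerE Hq Hq' Hp Hp' !mulr1.
Qed.

(** Every integer power of 1 + z is regular with value 1 at 0, so only z^e matters. *)
Lemma residue_mono (e j : int) : 0 <= e ->
  residue (zF2 ^ e * (1 + zF2) ^ j) (e == 0)%:R.
Proof.
move=> He; rewrite -[X in residue _ X]mulr1.
have Rz : residue zF2 0 by have := residue_poly 'X; rewrite hornerX.
have R1 : residue 1 1 by have := residue_poly 1; rewrite hornerC rmorph1.
have Rn f r n : residue f r -> residue (f ^+ n) (r ^+ n).
  move=> Hf; elim: n => [|n IH]; first by rewrite !expr0.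
  by rewrite !exprS; apply: residueM.
have Rz1 n : residue ((1 + zF2) ^+ n) 1.
  by have := Rn _ _ n (residueD R1 Rz); rewrite addr0 expr1n.
apply: residueM; last by case: j => n; [exact: Rz1|exact/residueV/Rz1].
case: e He => // -[|n] _ //.
by have := Rn _ _ n.+1 Rz; rewrite expr0n.
Qed.

Lemma ratF2_2 : 2 = 0 :> ratF2.
Proof.
have -> : 2 = tofrac (2%:R%:P : {poly 'F_2}) :> ratF2 by rewrite polyC_natr rmorph_nat.
by rewrite (_ : 2%:R = 0 :> 'F_2) ?rmorph0 //; apply/eqP.
Qed.

Lemma zF2_neq0 : zF2 != 0.
Proof. by rewrite tofrac_eq0 polyX_eq0. Qed.

Lemma zF2S_neq0 : 1 + zF2 != 0.
Proof.
have -> : 1 + zF2 = tofrac ('X + 1) by rewrite rmorphD rmorph1 addrC.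
by rewrite tofrac_eq0 -[1]/(1%:P) -size_poly_eq0 size_XaddC.
Qed.

(* [v] is the order of vanishing at 0 of the monomials under the substitution
   x := al; a lamp configuration with a unique pole of maximal order can only be
   produced by visiting a position with a pole of at least that order. *)
Lemma trace_visits (al : ratF2) (v w : int * int -> int) u L c0 L0 :
  al != 0 -> 1 + al != 0 -> (forall c, mono al c = zF2 ^ v c * (1 + zF2) ^ w c) ->
  aeval u === lamps L -> perm_eq L (c0 :: L0) ->
  (forall c, c \in L0 -> v c0 < v c) ->
  exists2 d, d \in 0 :: trace 0 u & v d <= v c0.
Proof.
move=> al0 al1 Hmono Hu HL Hv.
case: (boolP (has (fun d => v d <= v c0) (0 :: trace 0 u))) => [/hasP//|/hasPn Hno].
(* Here [I] means vanishing to order greater than [v c0]. If no visited position had order at most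
   [v c0], the whole sum and its terms over [L0] would satisfy [I], whereas the term at [c0] has
   order exactly [v c0]. *)
pose I f := residue (zF2 ^ (- v c0) * f) 0.
have I0 : I 0 by rewrite /I mulr0; have := residue_poly 0; rewrite rmorph0 horner0.
have ID f g : I f -> I g -> I (f + g).
  by rewrite /I mulrDr => Hf Hg; have := residueD Hf Hg; rewrite addr0.
have Im c : v c0 < v c -> I (mono al c).
  move=> Hc; rewrite /I Hmono mulrA -expfzDr ?zF2_neq0 //.
  have := @residue_mono (- v c0 + v c) (w c) _.
  have -> : (- v c0 + v c == 0) = false by lia.
  by apply; lia.
have H1 : I (\sum_(c <- L) mono al c).
  rewrite -(ev_lamps al0 al1 ratF2_2) -(ev_gequiv al0 al1 ratF2_2 Hu).
  rewrite -[X in I X]mul1r -(mono0 al); apply: (ev_trace al0 al1) => // d Hd.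
  by apply: Im; rewrite ltNge; apply: Hno.
have H2 : I (\sum_(c <- L0) mono al c).
  rewrite big_seq; apply: (big_ind I) => // c Hc; exact/Im/Hv.
move: H1; rewrite (perm_big _ HL) big_cons /I mulrDr => H1.
have H3 : residue (zF2 ^ (- v c0) * mono al c0) 1.
  rewrite Hmono mulrA -expfzDr ?zF2_neq0 // addNr.
  exact: (@residue_mono 0).
have := residue_uniq H1 (residueD H3 H2).
by move/eqP; rewrite addr0 eq_sym oner_eq0.
Qed.

(** * Variation of coordinates and the lower bound on length *)

Fixpoint variation (s : int) (l : seq int) : int :=
  if l is x :: l' then `|x - s| + variation x l' else 0.

Lemma variation_visit (s : int) (l : seq int) (x : int) : x \in s :: l ->
  `|s - x| + `|x - last s l| <= variation s l.
Proof.
elim: l s x => [|y l IH] s x; rewrite inE.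
  by move=> /eqP->; rewrite /=; lia.
case: eqP => [->|_] /= Hx; last by have := IH y x Hx; lia.
by have := IH y y (mem_head _ _); lia.
Qed.

(** The two alternatives are the two possible orders of visiting [x] and [y]. *)
Lemma variation_visit2 (s : int) (l : seq int) (x y : int) : x \in s :: l -> y \in s :: l ->
  `|s - x| + `|x - y| + `|y - last s l| <= variation s l \/
  `|s - y| + `|y - x| + `|x - last s l| <= variation s l.
Proof.
elim: l s => [|z l IH] s Hx Hy.
  by move: Hx Hy; rewrite !inE => /eqP-> /eqP->; rewrite /=; lia.
have Vx := variation_visit Hx; have Vy := variation_visit Hy.
move: Vx Vy Hx Hy => /= Vx Vy; rewrite !(in_cons s).
case: (x =P s) => [-> _ _|_ /= Hx]; first by lia.
case: (y =P s) => [-> _|_ /= Hy]; first by lia.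
by have := IH z Hx Hy; lia.
Qed.

Lemma variation_loop (s : int) (l : seq int) (x y : int) : last s l = s ->
  x \in s :: l -> y \in s :: l -> 2 * `|x - y| <= variation s l.
Proof.
by move=> Hl Hx Hy; have := variation_visit2 Hx Hy; rewrite Hl; lia.
Qed.

Lemma variation_trace c u : variation c.1 (map fst (trace c u)) +
  variation c.2 (map snd (trace c u)) <= (size u)%:Z.
Proof.
elim: u c => [//|y u IH] c /=.
by have := IH (c + ashift y); have := ball_ashift y; rewrite /ball /=; lia.
Qed.

(** The element x^n + x^-n + (1+x)^-n, whose terms give poles of order n at infinity, 0 and 1
    respectively. *)
Definition dead_end (n : nat) : seq (int * int) :=
  [:: (n%:Z, 0); (- n%:Z, 0); (0, - n%:Z)].

Lemma dead_end_length (n : nat) u : (0 < n)%N ->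
  aeval u === lamps (dead_end n) -> (6 * n <= size u)%N.
Proof.
move=> n0 Hu.
have z0 := zF2_neq0; have z1 := zF2S_neq0.
(* The pole at x = 0, seen through x := z. *)
have [d1 Hd1 V1] : exists2 d, d \in 0 :: trace 0 u & d.1 <= - n%:Z.
  apply: (trace_visits (c0 := (- n%:Z, 0)) (L0 := [:: (n%:Z, 0); (0, - n%:Z)])
    z0 z1 (fun c => erefl) Hu).
    by apply/permPl; exact: (perm_catCA [:: _] [:: _] [:: _]).
  by move=> c; rewrite !inE => /orP[] /eqP-> /=; lia.
(* The pole at x = 1, seen through x := 1 + z, which exchanges the two exponents. *)
have z2 : 1 + (1 + zF2) = zF2 by rewrite addrA -[1 + 1]/2 ratF2_2 add0r.
have z2' : 1 + (1 + zF2) != 0 by rewrite z2.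
have m2 c : mono (1 + zF2) c = zF2 ^ c.2 * (1 + zF2) ^ c.1.
  by rewrite /mono z2 mulrC.
have [d2 Hd2 V2] : exists2 d, d \in 0 :: trace 0 u & d.2 <= - n%:Z.
  apply: (trace_visits (c0 := (0, - n%:Z)) (L0 := [:: (n%:Z, 0); (- n%:Z, 0)])
    z1 z2' m2 Hu).
    by apply/permPl; exact: (perm_catC [:: _; _] [:: _]).
  by move=> c; rewrite !inE => /orP[] /eqP-> /=; lia.
(* The pole at infinity, seen through x := 1/z; the order of vanishing becomes minus the total
   degree. *)
have z3 : 1 + zF2^-1 = zF2^-1 * (1 + zF2) by rewrite mulrDr mulr1 mulVf // addrC.
have z0' : zF2^-1 != 0 := invr_neq0 z0.
have z3' : 1 + zF2^-1 != 0 by rewrite z3; exact: mulf_neq0 z0' z1.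
have m3 c : mono zF2^-1 c = zF2 ^ (- (c.1 + c.2)) * (1 + zF2) ^ c.2.
  by rewrite /mono z3 expfzMl mulrA -(expfzDr _ _ z0') exprz_inv.
have [d3 Hd3 V3] : exists2 d, d \in 0 :: trace 0 u & - (d.1 + d.2) <= - (n%:Z + 0).
  apply: (trace_visits (c0 := (n%:Z, 0)) (L0 := [:: (- n%:Z, 0); (0, - n%:Z)])
    (v := fun c => - (c.1 + c.2)) z0' z3' m3 Hu).
    exact: perm_refl.
  by move=> c; rewrite !inE => /orP[] /eqP-> /=; lia.
have Hl : last 0 (trace 0 u) = 0.
  by rewrite last_trace (tot_gequiv Hu) tot_lamps addr0.
have VT : variation 0 (map fst (trace 0 u)) + variation 0 (map snd (trace 0 u))
    <= (size u)%:Z := variation_trace 0 u.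
(* Since d1.1 <= -n, d2.2 <= -n and d3.1 + d3.2 >= n, the two differences add up to at least 3n; the
   walk is closed, which doubles this to 6n. *)
have W1 : 2 * `|d1.1 - d3.1| <= variation 0 (map fst (trace 0 u)).
  apply: variation_loop (map_f fst Hd1) (map_f fst Hd3).
  by rewrite (last_map fst _ 0) Hl.
have W2 : 2 * `|d2.2 - d3.2| <= variation 0 (map snd (trace 0 u)).
  apply: variation_loop (map_f snd Hd2) (map_f snd Hd3).
  by rewrite (last_map snd _ 0) Hl.
by lia.
Qed.

(** * The depth estimate *)

Lemma size_aeval u : (size (aeval u) <= 3 * size u)%N.
Proof.
elim: u => [//|y u IH]; rewrite aeval_cons size_cat mulnS leq_add //.
by case: y => -[] [].
Qed.

Local Close Scope ring_scope.

Theorem theorem1p1 :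
  forall N : nat, 1 <= N -> exists g : seq letter, depth_ge g N.
Proof.
(* The factor 3 is the length of the longest generators, [ata] and [asa]: fewer than N of them spell
   at most n letters. *)
move=> N N0; pose n := (3 * N)%N; have n0 : (0 < n)%N by rewrite /n; lia.
exists (lamps (dead_end n)) => k [[u [Hu Eu]] _] h Hh m [v [Hv Ev]].
rewrite leqNgt; apply/negP => Hm; apply: Hh.
have Hk : (6 * n <= k)%N := leq_trans (dead_end_length n0 Eu) Hu.
have [L [d [Ed HL Hd]]] := word_normal_form (aeval v).
have Hsz : (size (aeval v) <= n)%N.
  by apply: leq_trans (size_aeval v) _; rewrite /n; lia.
(* As g ends at the origin, the lamps of [aeval v] join those of g without translation. All lie in
   the triangle, so h has length at most 6n <= k. *)
have [| |x [Hx Ex]] := @dist_le_triangle n (dead_end n ++ L) d n0.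
- move=> c; rewrite mem_cat -[_ \in triangle n]/(triangle n c) => /orP[].
    by rewrite !inE => /or3P[] /eqP->; rewrite /triangle /=; lia.
  by move/HL; rewrite -topredE /= /ball /triangle; lia.
- by move: Hd; rewrite /ball; lia.
exists x; split; first exact: leq_trans Hk.
rewrite Ex lamps_cat -catA -Ed; exact: Ev.
Qed.
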